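(* Let $d\geq 2$ be an integer. Let $m^{\ast}:=\frac{d-1}{4}$ if $d$ is prime and $m^{\ast}:=\frac{d-1}{3}$ otherwise. Let $m$ be an integer with $m>m^{\ast}$ and let $g\in\mathbb{C}^d$ be such that $\{-m,\dots,m\}\times\mathbb{Z}_d\subseteq\operatorname{supp}(V_gg)$. Then the pair $(g,\hat{g})$ does strong two-window phase retrieval.
   Context: Let $\mathbb{Z}_d:=\mathbb{Z}/d\mathbb{Z}$. An element $f\in\mathbb{C}^d$ is regarded as a function $\mathbb{Z}_d\to\mathbb{C}$, $j\mapsto f_j$, with all indices interpreted modulo $d$. For integers $k_1<k_2$, $\{k_1,\dots,k_2\}$ denotes the subset $\{[j] : k_1\le j\le k_2\}$ of $\mathbb{Z}_d$, where $[j]$ is the class of $j$ modulo $d$. Let $\mathbb{T}:=\{z\in\mathbb{C} : |z|=1\}$. The Fourier transform of $f\in\mathbb{C}^d$ is $\hat f_l:=\sum_{j=0}^{d-1}f_j e^{-2\pi i jl/d}$, $l\in\mathbb{Z}_d$. For $f,g\in\mathbb{C}^d$, the short-time Fourier transform of $f$ with respect to the window $g$ is $V_gf:\mathbb{Z}_d^2\to\mathbb{C}$, $V_gf(k,l):=\sum_{j=0}^{d-1}f_j\overline{g_{j-k}}e^{-2\pi i jl/d}$. The support of a function $h$ on a finite set $M$ is $\operatorname{supp}(h):=\{x\in M : h(x)\neq 0\}$. A signal $f\in\mathbb{C}^d$ is called phase retrievable w.r.t. $g\in\mathbb{C}^d$ if for every $\tilde f\in\mathbb{C}^d$ with $|V_g\tilde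 f|=|V_gf|$ (pointwise on $\mathbb{Z}_d^2$) there exists $\gamma\in\mathbb{T}$ with $\tilde f=\gamma f$. Windows $g_1,g_2\in\mathbb{C}^d$ (or the pair $(g_1,g_2)$) are said to do strong two-window phase retrieval if every $f\in\mathbb{C}^d$ is phase retrievable w.r.t. at least one of $g_1$ or $g_2$. *)

(* Defs.v *)
From mathcomp Require Import all_boot all_order all_algebra.
From mathcomp Require Import complex.
From mathcomp Require Import all_classical all_reals all_analysis.

Set Implicit Arguments.
Unset Strict Implicit.
Unset Printing Implicit Defensive.

Import Order.TTheory GRing.Theory Num.Theory.

Local Open Scope classical_set_scope.
Local Open Scope ring_scope.

(* The complex numbers are R[i] for R : realType. The group Z/dZ is 'Z_d, which
   is the ring of integers modulo d only when 1 < d: the definitions below have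
   their intended meaning only in that case.
   Arithmetic on elements of 'Z_d, as in j - k, is modulo d. *)

Section Definitions.
Variable R : realType.

Definition cis (t : R) : R[i] := Complex (cos t) (sin t).

(* exp(-2 pi i j l / d), for the representatives of j and l in {0, ..., d-1} *)
Definition fourier_kernel (d : nat) (j l : 'Z_d) : R[i] :=
  cis (- (2 * pi * (j * l)%N%:R / d%:R)).

Definition fourier (d : nat) (f : 'Z_d -> R[i]) (l : 'Z_d) : R[i] :=
  \sum_(j : 'Z_d) f j * fourier_kernel j l.

Definition stft (d : nat) (g f : 'Z_d -> R[i]) (kl : 'Z_d * 'Z_d) : R[i] :=
  \sum_(j : 'Z_d) f j * (g (j - kl.1))^* * fourier_kernel j kl.2.

Definition supp (M : finType) (h : M -> R[i]) : set M := [set x | h x != 0].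

Definition phase_retrievable (d : nat) (g f : 'Z_d -> R[i]) : Prop :=
  forall f' : 'Z_d -> R[i],
    (forall kl, `|stft g f' kl| = `|stft g f kl|) ->
    exists2 gamma : R[i], `|gamma| = 1 & forall j, f' j = gamma * f j.

Definition strong_two_window_phase_retrieval (d : nat) (g1 g2 : 'Z_d -> R[i]) :
  Prop :=
  forall f : 'Z_d -> R[i], phase_retrievable g1 f \/ phase_retrievable g2 f.

End Definitions.

(* {k1, ..., k2}, the residue classes of the integers from k1 to k2 *)
Definition residues (d : nat) (k1 k2 : int) : set 'Z_d :=
  [set k%:~R | k in [set k : int | k1 <= k <= k2]].
Arguments residues : clear implicits.

Definition mstar (d : nat) : rat :=
  if prime d then (d%:R - 1) / 4 else (d%:R - 1) / 3.

(* Main.v *)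
Require Import Defs.
From mathcomp Require Import all_boot all_order all_algebra.
From mathcomp Require Import complex.
From mathcomp Require Import all_classical all_reals all_analysis.
From mathcomp Require Import ring lra zify.

(** Write [A_f(n, s)] for [stft f f (n, s)].  Summing the squared modulus of
    [stft g f] against characters of both variables gives, up to the factor
    [d], the product of [A_f(n, s)] and the conjugate of [A_g(n, s)]
    ([spectrogram_fourier]).  So two signals with the same [|stft g _|] have the
    same [A] wherever [A_g] does not vanish ([ambiguity_eq]), and when this
    holds for a given lag [n] and all [s], Fourier inversion shows that they
    have the same products [f j * (f (j - n))^*] ([lag_product_eq]).  The
    Fourier transform rotates [A] by a quarter turn ([stft_fourier_diag]).  If
    [A_g] does not vanish for the lags from [-m] to [m], then the window [g]
    determines these products for [f], and the window [fourier g] determines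
    them for [fourier f].

    Signals with the same products for the lags from [0] to [m] have the same
    modulus, and their quotient is locally constant: it takes the same value at
    two points of the support at distance at most [m].  If the quotient is not
    constant, then on each of the two arcs between two points where it differs
    there is a run of [m] zeros.  So either [f] is determined up to a phase, or
    it is nonzero with at least [2 * m] zeros and a run of [m] consecutive zeros
    ([unimodular_multiple_or_zero_runs]).

    If both windows failed for [f], this description would apply to both [f]
    and [fourier f], which an uncertainty principle excludes.
    - For any [d] with [d <= 3 * m], the support of [f] has at most
      [d - 2 * m <= m] points, while [fourier f] vanishes at [m] consecutive
      points; a Vandermonde determinant then forces [f = 0]
      ([fourier_zero_run]).
    - For [d] prime with [d <= 4 * m], the support of [f] has at most
      [d - 2 * m <= 2 * m] points, and [fourier f] has at least [2 * m] zeros;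
      Chebotarev's theorem, that no minor of the Fourier matrix of prime order
      vanishes ([chebotarev_minor_neq0]), then forces [f = 0]
      ([prime_uncertainty]). *)

Set Implicit Arguments.
Unset Strict Implicit.
Unset Printing Implicit Defensive.

Import Order.TTheory GRing.Theory Num.Theory.

Local Open Scope ring_scope.

(** * Chebotarev's theorem on the minors of the Fourier matrix *)

Lemma det_neq0_ker (K : idomainType) (k : nat) (A : 'M[K]_k) (v : 'I_k -> K) :
  \det A != 0 -> (forall i, \sum_j A i j * v j = 0) -> forall j, v j = 0.
Proof.
move=> detA Av0 j; apply/eqP; apply: contraNT detA => vj.
rewrite -det_tr; apply/det0P; exists (\row_j v j).
  by apply: contra_neq vj => /rowP/(_ j); rewrite !mxE.
apply/rowP=> i; rewrite !mxE -[RHS](Av0 i).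
by apply: eq_bigr => l _; rewrite !mxE mulrC.
Qed.

Lemma det_Vandermonde_neq0 (K : idomainType) (k : nat) (a : 'I_k -> K) :
  injective a -> \det (Vandermonde k (\row_j a j)) != 0.
Proof.
move=> a_inj; rewrite det_Vandermonde; apply/prodf_neq0 => i _.
apply/prodf_neq0 => j ltij; rewrite !mxE subr_eq0.
by apply: contraTneq ltij => /a_inj->; rewrite ltnn.
Qed.

(** This replaces the reduction of the ring generated by [w] modulo its ideal
    [(1 - w)].  The matrix [P] of the cyclic shift has [w] as an eigenvalue, so
    [H(P)] is singular over the integers, hence modulo [p].  Modulo [p], since
    [P ^+ p = 1], the Frobenius gives that [H(P) ^+ p] is the scalar matrix of
    [H(1) ^+ p]. *)
Lemma int_poly_root1_modp (K : numDomainType) (p : nat) (w : K)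
    (H : {poly int}) :
  prime p -> w ^+ p = 1 -> root (map_poly intr H) w -> H.[1]%:~R = 0 :> 'F_p.
Proof.
move=> p_pr wp1 Hw; have p_gt1 := prime_gt1 p_pr.
case: p p_pr p_gt1 wp1 => [|[|n]] // p_pr _ wp1; set p := n.+2 in p_pr wp1 *.
pose P (R : comNzRingType) : 'M[R]_n.+2 := \matrix_(i, j) (j == i + 1)%:R.
have detHP : \det (horner_mx (P int) H) = 0.
  apply: (@intr_inj K); rewrite rmorph0 -det_map_mx map_horner_mx /=.
  have -> : map_mx intr (P int) = P K.
    by apply/matrixP=> i j; rewrite !mxE; case: (_ == _).
  apply/eqP; rewrite -det_tr; apply/det0P.
  exists (\row_i w ^+ i).
    by apply/eqP => /rowP/(_ 0)/eqP; rewrite !mxE oner_eq0.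
  apply: (can_inj trmxK); rewrite trmx_mul trmxK trmx0.
  set e := _^T.
  (* [e] is a column eigenvector of the shift, for the eigenvalue [w]. *)
  have Pe : P K *m e = w *: e.
    apply/colP=> i; rewrite !mxE (bigD1 (i + 1)) //= big1 => [|j /negPf nj].
      rewrite !mxE eqxx mul1r addr0 -exprS /= (@modn_small 1) // addn1.
      by rewrite -[RHS](expr_mod _ wp1).
    by rewrite !mxE nj mul0r.
  have HPe q : horner_mx (P K) q *m e = q.[w] *: e.
    elim/poly_ind: q => [|q c IH].
      by rewrite rmorph0 horner0 mul0mx scale0r.
    rewrite rmorphD rmorphM /= horner_mx_X horner_mx_C mulmxDl -mulmxA Pe.
    by rewrite -scalemxAr IH scalerA mul_scalar_mx -scalerDl hornerMXaddC mulrC.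
  by rewrite HPe (rootP Hw) scale0r.
have p_char : p \in [pchar {poly 'F_p}] by rewrite pchar_poly pchar_Fp.
have PXj j : P 'F_p ^+ j = \matrix_(i, l) (l == i + j%:R)%:R.
  elim: j => [|j IH]; first by apply/matrixP=> i l; rewrite !mxE addr0 eq_sym.
  rewrite exprS IH; apply/matrixP=> i l; rewrite !mxE (bigD1 (i + 1)) //= big1.
    by rewrite !mxE eqxx mul1r addr0 -addrA -natr1 [1 + _]addrC.
  by move=> x /negPf nx; rewrite !mxE nx mul0r.
have Pp1 : P 'F_p ^+ p = 1.
  rewrite PXj; apply/matrixP=> i l; rewrite !mxE.
  by rewrite (_ : p%:R = 0) ?addr0 1?eq_sym //; apply: (@pchar_Zp p).
set h := map_poly intr H : {poly 'F_p}.
have h1 : H.[1]%:~R = h.[1] by rewrite -[1](rmorph1 intr) horner_map.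
have /factor_theorem[q hq] : root (h - (h.[1])%:P) 1.
  by rewrite rootE !hornerE subrr.
have detHPp : \det (horner_mx (P 'F_p) h) = 0.
  rewrite -[RHS](rmorph0 intr) -detHP -det_map_mx map_horner_mx /=.
  congr (\det (horner_mx _ _)).
  by apply/matrixP=> i j; rewrite !mxE; case: (_ == _).
have hpE : h ^+ p = (h.[1] ^+ p)%:P + q ^+ p * ('X^p - 1).
  rewrite -[h in LHS](subrK h.[1]%:P) hq addrC.
  rewrite -(pFrobenius_autE p_char) pFrobenius_autD_comm; last exact: mulrC.
  rewrite !pFrobenius_autE.
  rewrite -polyC_exp; congr (_ + _).
  rewrite exprMn; congr (_ * _).
  rewrite -(pFrobenius_autE p_char) pFrobenius_autB_comm; last exact: mulrC.
  by rewrite !pFrobenius_autE expr1n.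
have : \det (horner_mx (P 'F_p) (h ^+ p)) = 0.
  by rewrite exprS rmorphM /= det_mulmx detHPp mul0r.
rewrite hpE rmorphD (rmorphM (horner_mx (P 'F_p))).
rewrite (rmorphB (horner_mx (P 'F_p))) rmorph1.
rewrite (rmorphXn (horner_mx (P 'F_p)) p 'X).
rewrite -[GRing.RMorphism.sort _ 'X]/(horner_mx _ 'X).
rewrite horner_mx_X Pp1 subrr mulr0 addr0.
rewrite -[GRing.RMorphism.sort _ _]/(horner_mx _ _%:P) horner_mx_C det_scalar.
rewrite -exprM h1 => /eqP.
by rewrite expf_eq0 => /andP[_ /eqP].
Qed.

(** A combination of [k] powers of ['X] whose exponents are distinct in [K]
    cannot vanish to order [k] at [1].  Each application of the operator
    [f |-> 'X * f^`()] lowers the order of vanishing by at most one and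
    multiplies ['X^b] by [b]; evaluating at [1] the result of fewer than [k]
    applications gives a Vandermonde system for the coefficients. *)
Lemma sparse_poly_eq0 (K : fieldType) (k : nat) (b : 'I_k -> nat)
    (v : 'I_k -> K) (q : {poly K}) :
    injective (fun j => (b j)%:R : K) ->
  \sum_j v j *: 'X^(b j) = q * ('X - 1) ^+ k -> forall j, v j = 0.
Proof.
move=> b_inj fE.
pose V := Vandermonde k (\row_j ((b j)%:R : K)).
apply: (@det_neq0_ker _ _ V); first exact: det_Vandermonde_neq0.
have mult i : (i <= k)%N ->
    exists r, \sum_j (v j * (b j)%:R ^+ i) *: 'X^(b j) =
      r * ('X - 1) ^+ (k - i).
  elim: i => [|i IH] lik.
    exists q; rewrite subn0 -fE; apply: eq_bigr => j _.
    by rewrite expr0 mulr1.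
  have [r rE] := IH (ltnW lik).
  exists ('X * (r^`() * ('X - 1) + r *+ (k - i))).
  have -> : \sum_j (v j * (b j)%:R ^+ i.+1) *: 'X^(b j) =
      'X * (\sum_j (v j * (b j)%:R ^+ i) *: 'X^(b j))^`().
    rewrite raddf_sum mulr_sumr; apply: eq_bigr => j _.
    rewrite /= derivZ derivXn -scaler_nat scalerA -scalerAr exprSr mulrA.
    case: (b j) => [|c]; first by rewrite mulr0 !scale0r.
    by rewrite -exprS.
  rewrite rE -(subnSK lik) derivM deriv_exp derivB derivX derivC subr0 mul1r /=.
  by rewrite -mulrA mulrDl exprS mulrA mulrnAl mulrnAr.
move=> i; have [r] := mult i (ltnW (ltn_ord i)).
move/(congr1 (fun f => f.[1])); rewrite hornerM horner_exp !hornerE subrr.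
rewrite expr0n subn_eq0 leqNgt ltn_ord mulr0 => fi0.
rewrite -[RHS]fi0 horner_sum; apply: eq_bigr => j _.
by rewrite !mxE hornerZ hornerXn expr1n mulr1 mulrC.
Qed.

(** Over the integer polynomials in an indeterminate [x] specialized to [w],
    reduce [T ^+ b j] modulo the monic polynomial with roots [x ^+ a i].  The
    minor becomes the product of a Vandermonde matrix and the specialization of
    the matrix [rho] of the coefficients of the remainders.  If [\det rho]
    vanished at [w], it would vanish modulo [p] at [1], where all roots merge:
    some combination of the [T ^+ b j] would be divisible by [(T - 1) ^+ k],
    against [sparse_poly_eq0]. *)
Theorem chebotarev_minor_neq0 (K : numDomainType) (p k : nat) (w : K)
    (a b : 'I_k -> 'I_p) :
    prime p -> p.-primitive_root w -> injective a -> injective b ->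
  \det (\matrix_(i, j) w ^+ (a i * b j)) != 0.
Proof.
move=> p_pr w_prim a_inj b_inj.
pose D : {poly {poly int}} := \prod_(i < k) ('X - ('X^(a i))%:P).
pose Q j := Pdiv.Ring.rdivp 'X^(b j) D.
pose r j := Pdiv.Ring.rmodp 'X^(b j) D.
have D_monic : D \is monic by apply: monic_prod_XsubC.
have rE j : 'X^(b j) = Q j * D + r j by apply: Pdiv.RingMonic.rdivp_eq.
have size_r j : (size (r j) <= k)%N.
  rewrite -ltnS (_ : k.+1 = size D) ?Pdiv.Ring.ltn_rmodp ?monic_neq0 //.
  by rewrite size_prod_XsubC /index_enum -enumT size_enum_ord.
pose rho : 'M[{poly int}]_k := \matrix_(n, j) (r j)`_n.
have [phi phiE] : {phi : {rmorphism {poly int} -> K} |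
    forall h, phi h = (map_poly intr h).[w]}.
  by exists (horner_eval w \o map_poly intr).
have [psi psiE] : {psi : {rmorphism {poly int} -> 'F_p} |
    forall h, psi h = h.[1]%:~R}.
  by exists (intr \o horner_eval 1).
have phiX n : phi 'X^n = w ^+ n by rewrite phiE map_polyXn hornerXn.
have psiX n : psi 'X^n = 1 by rewrite psiE hornerXn expr1n.
have wa_inj : injective (fun i => w ^+ a i).
  move=> i j /eqP; rewrite (eq_prim_root_expr w_prim) !modn_small // => /eqP.
  by move=> /val_inj/a_inj.
have -> : \matrix_(i, j) w ^+ (a i * b j) =
    (Vandermonde k (\row_i w ^+ a i))^T *m map_mx phi rho.
  apply/matrixP=> i j; rewrite !mxE.
  have /(congr1 (fun f => (map_poly phi f).[w ^+ a i])) := rE j.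
  rewrite map_polyXn hornerXn -exprM => ->.
  rewrite rmorphD rmorphM /= hornerD hornerM map_prod_XsubC.
  have -> : (\prod_(l < k) ('X - (phi 'X^(a l))%:P)).[w ^+ a i] = 0.
    by rewrite horner_prod (bigD1 i) //= hornerXsubC phiX subrr mul0r.
  rewrite mulr0 add0r (@horner_coef_wide _ k) ?(leq_trans (size_poly _ _)) //.
  by apply: eq_bigr => n _; rewrite !mxE coef_map mulrC.
rewrite det_mulmx det_tr mulf_neq0 ?det_Vandermonde_neq0 // det_map_mx.
apply/eqP; rewrite phiE => detw.
have : psi (\det rho) = 0.
  rewrite psiE.
  apply: (@int_poly_root1_modp K p w) => //; first exact: prim_expr_order.
  by apply/rootP.
rewrite -det_map_mx -det_tr => /eqP/det0P[v /eqP v0 /rowP vr].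
apply: v0; apply/rowP=> j; rewrite mxE.
apply: (@sparse_poly_eq0 'F_p k (fun j => b j) (v 0)
  (\sum_j v 0 j *: map_poly psi (Q j))).
  move=> i l /(congr1 val); rewrite /= !val_Fp_nat // !modn_small //.
  by move=> /val_inj/b_inj.
have DE : map_poly psi D = ('X - 1) ^+ k.
  rewrite map_prod_XsubC (eq_bigr (fun=> 'X - 1)) ?prodr_const ?card_ord //.
  by move=> i _; rewrite psiX.
have XE i : 'X^(b i) = map_poly psi (Q i) * ('X - 1) ^+ k + map_poly psi (r i).
  by rewrite -DE -rmorphM -rmorphD /= -rE map_polyXn.
under eq_bigr do rewrite XE scalerDr scalerAl.
rewrite big_split /= -mulr_suml -[RHS]addr0; congr (_ + _).
apply/polyP=> n; rewrite coef0 coef_sum.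
have [ltnk | lekn] := ltnP n k; last first.
  apply: big1 => i _; rewrite coefZ nth_default ?mulr0 //.
  exact: leq_trans (size_poly _ _) (leq_trans (size_r i) lekn).
have := vr (Ordinal ltnk); rewrite [RHS]mxE [LHS]mxE => vrn; rewrite -[RHS]vrn.
by apply: eq_bigr => i _; rewrite coefZ coef_map !mxE.
Qed.

(** * The Fourier transform on the integers modulo d *)

Section RootOfUnity.
Variable R : realType.

Lemma cis0 : cis (0 : R) = 1.
Proof. by rewrite /cis sin0 cos0. Qed.

Lemma cisD (x y : R) : cis (x + y) = cis x * cis y.
Proof.
rewrite /cis cosD sinD; apply/eqP.
by rewrite eq_complex /= !eqxx /= [in X in _ == X]addrC.
Qed.

Lemma cisMn (x : R) n : cis (x *+ n) = cis x ^+ n.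
Proof. by elim: n => [|n IH]; rewrite ?mulr0n ?cis0 // mulrS cisD IH exprS. Qed.

Lemma norm_cis (x : R) : `|cis x| = 1.
Proof. by rewrite normc_def /= cos2Dsin2 sqrtr1. Qed.

(** The root of unity exp(-2 pi i / d), with the sign of the Fourier kernel. *)
Definition omega (d : nat) : R[i] := cis (- (2 * pi / d%:R)).

Lemma omega_prim_root (d : nat) : (0 < d)%N -> d.-primitive_root (omega d).
Proof.
move=> d_gt0; have d0 : d%:R != 0 :> R by rewrite pnatr_eq0 -lt0n.
apply/andP; split=> //; apply/forallP => -[i ltid] /=.
rewrite unity_rootE -cisMn.
have [->|nid] := eqVneq i.+1 d.
  rewrite mulNrn -[X in - X]mulr_natr divfK // mulr_natl.
  by rewrite /cis cosN sinN cos2pi sin2pi oppr0 !eqxx.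
apply/eqP/eqP => // /(congr1 (@complex.Re R)) /=.
set y : R := pi * i.+1%:R / d%:R.
have -> : - (2 * pi / d%:R) *+ i.+1 = - (y *+ 2) :> R.
  by rewrite -mulr_natr -[y *+ 2]mulr_natr /y; field.
rewrite cosN cos_mulr2n cos2sin2 => siny.
suff : 0 < sin y by nra.
apply: sin_gt0_pi; rewrite /y divr_gt0 ?mulr_gt0 ?pi_gt0 ?ltr0n //=.
by rewrite ltr_pdivrMr ?ltr0n // ltr_pM2l ?pi_gt0 // ltr_nat ltn_neqAle nid.
Qed.

End RootOfUnity.

Lemma fourierZ (R : realType) (d : nat) (c : R[i]) (f : 'Z_d -> R[i]) l :
  fourier (fun j => c * f j) l = c * fourier f l.
Proof. by rewrite /fourier mulr_sumr; apply: eq_bigr => j _; rewrite mulrA. Qed.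

Section FourierKernel.
Variables (R : realType) (d : nat).
Hypothesis d_gt1 : (1 < d)%N.
Local Notation e := (@fourier_kernel R d).
Let d_gt0 : (0 < d)%N := ltnW d_gt1.

Lemma fourier_kernelE (j l : 'Z_d) : e j l = omega R d ^+ (j * l).
Proof.
rewrite /fourier_kernel /omega -cisMn; congr (cis _); rewrite mulNrn.
by congr (- _); rewrite -[RHS]mulr_natr mulrAC.
Qed.

(** The representatives of [j] and [l] in [fourier_kernel j l] may be chosen
    arbitrarily, so the kernel is a bicharacter. *)
Lemma fourier_kernel_natr (m n : nat) : e m%:R n%:R = omega R d ^+ (m * n).
Proof.
rewrite fourier_kernelE !val_Zp_nat //.
rewrite -(prim_expr_mod (omega_prim_root R d_gt0)).
by rewrite modnMml modnMmr (prim_expr_mod (omega_prim_root R d_gt0)).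
Qed.

Lemma fourier_kernelC j l : e j l = e l j.
Proof. by rewrite !fourier_kernelE mulnC. Qed.

Lemma fourier_kernelDl i j l : e (i + j) l = e i l * e j l.
Proof.
rewrite -(natr_Zp i) -(natr_Zp j) -(natr_Zp l) -natrD !fourier_kernel_natr.
by rewrite mulnDl exprD.
Qed.

Lemma fourier_kernelDr i j l : e i (j + l) = e i j * e i l.
Proof. by rewrite fourier_kernelC fourier_kernelDl !(fourier_kernelC i). Qed.

Lemma fourier_kernel0l l : e 0 l = 1.
Proof. by rewrite fourier_kernelE mul0n expr0. Qed.

Lemma fourier_kernel0r l : e l 0 = 1.
Proof. by rewrite fourier_kernelC fourier_kernel0l. Qed.

Lemma fourier_kernel_neq0 j l : e j l != 0.
Proof. by rewrite -normr_eq0 norm_cis oner_eq0. Qed.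

Lemma conj_fourier_kernel j l : (e j l)^* = e (- j) l.
Proof.
apply: (mulfI (fourier_kernel_neq0 j l)).
by rewrite -fourier_kernelDl subrr fourier_kernel0l -normCK norm_cis expr1n.
Qed.

Lemma fourier_kernelNC j l : e (- j) l = e j (- l).
Proof.
apply: (mulfI (fourier_kernel_neq0 j l)).
rewrite -fourier_kernelDl -fourier_kernelDr !subrr.
by rewrite fourier_kernel0l fourier_kernel0r.
Qed.

Lemma sum_fourier_kernel j : \sum_l e j l = if j == 0 then d%:R else 0.
Proof.
have [->|j0] := eqVneq j 0.
  under eq_bigr do rewrite fourier_kernel0l.
  by rewrite sumr_const card_ord Zp_cast.
(* Translating [l] by 1 multiplies the sum by [e j 1], which is not 1. *)
apply: (@mulfI _ (e j 1 - 1)).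
  rewrite -(natr_Zp j) (fourier_kernel_natr j 1) muln1 subr_eq0.
  rewrite -(expr0 (omega R d)).
  rewrite (eq_prim_root_expr (omega_prim_root R d_gt0)) mod0n modn_small //.
  by rewrite -[X in (_ < X)%N](Zp_cast d_gt1).
rewrite mulr0 mulrBl mul1r mulr_sumr [X in _ - X](reindex_inj (addrI 1)) /=.
by under [X in _ - X]eq_bigr do rewrite fourier_kernelDr; rewrite subrr.
Qed.

Lemma fourier_inversion (f : 'Z_d -> R[i]) (i : 'Z_d) :
  \sum_l fourier f l * (e i l)^* = d%:R * f i.
Proof.
transitivity (\sum_j f j * \sum_l e (j - i) l).
  rewrite /fourier; under eq_bigr do rewrite mulr_suml.
  rewrite exchange_big; apply: eq_bigr => j _; rewrite mulr_sumr.
  apply: eq_bigr => l _.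
  by rewrite conj_fourier_kernel -mulrA -fourier_kernelDl.
under eq_bigr do rewrite sum_fourier_kernel subr_eq0 fun_if mulr0.
by rewrite -big_mkcond big_pred1_eq mulrC.
Qed.

Lemma fourier_inj (f f' : 'Z_d -> R[i]) :
  (forall l, fourier f l = fourier f' l) -> forall j, f j = f' j.
Proof.
move=> ff' j; have d0 : d%:R != 0 :> R[i] by rewrite pnatr_eq0 -lt0n.
apply: (mulfI d0); rewrite -!fourier_inversion.
by apply: eq_bigr => l _; rewrite ff'.
Qed.

End FourierKernel.

(** * Ambiguity functions and spectrograms *)

Section Ambiguity.
Variables (R : realType) (d : nat).
Hypothesis d_gt1 : (1 < d)%N.
Local Notation e := (@fourier_kernel R d).

Lemma parseval (u v : 'Z_d -> R[i]) :
  \sum_l fourier u l * (fourier v l)^* = d%:R * \sum_j u j * (v j)^*.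
Proof.
transitivity (\sum_j (v j)^* * \sum_l fourier u l * (e j l)^*).
  under [RHS]eq_bigr do rewrite mulr_sumr.
  rewrite exchange_big; apply: eq_bigr => l _.
  rewrite {2}/fourier rmorph_sum mulr_sumr; apply: eq_bigr => j _.
  by rewrite rmorphM mulrCA.
rewrite mulr_sumr; apply: eq_bigr => j _.
by rewrite fourier_inversion // mulrC mulrA.
Qed.

Lemma fourier_translate (u : 'Z_d -> R[i]) (n l : 'Z_d) :
  fourier (fun j => u (j - n)) l = e n l * fourier u l.
Proof.
rewrite /fourier (reindex_inj (addIr n)) mulr_sumr; apply: eq_bigr => j _ /=.
by rewrite addrK fourier_kernelDl // mulrA mulrC.
Qed.

(** For fixed [k], the sum over [l] is the autocorrelation at [n] of the
    windowed signal [u k], by Parseval; the sum over [k] then decouples [f]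
    from [g]. *)
Lemma spectrogram_fourier (g f : 'Z_d -> R[i]) (n s : 'Z_d) :
  \sum_k e k s * (\sum_l `|stft g f (k, l)| ^+ 2 * (e n l)^*) =
  d%:R * (stft f f (n, s) * (stft g g (n, s))^*).
Proof.
pose u k (j : 'Z_d) := f j * (g (j - k))^*.
transitivity (\sum_k e k s * (d%:R * \sum_j u k j * (u k (j - n))^*)).
  apply: eq_bigr => k _; rewrite -parseval; congr (_ * _).
  apply: eq_bigr => l _.
  by rewrite fourier_translate rmorphM [in RHS]mulrCA [RHS]mulrC normCK.
transitivity (d%:R * \sum_j f j * (f (j - n))^* *
    \sum_k e k s * (g (j - k))^* * g (j - k - n)).
  rewrite mulr_sumr; under [RHS]eq_bigr do rewrite !mulr_sumr.
  rewrite exchange_big; apply: eq_bigr => k _; rewrite !mulr_sumr.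
  apply: eq_bigr => j _; rewrite /u !rmorphM /= conjCK [j - n - k]addrAC.
  by ring.
congr (_ * _); rewrite /stft mulr_suml; apply: eq_bigr => j _ /=.
rewrite -!mulrA; congr (_ * (_ * _)).
(* The substitution [k = j - i] moves the window to the origin. *)
rewrite (reindex_inj (@subrI _ j)) rmorph_sum mulr_sumr; apply: eq_bigr => i _.
rewrite subKr fourier_kernelDl // !rmorphM /= conjCK conj_fourier_kernel //.
by ring.
Qed.

Lemma stft_fourier_diag (g : 'Z_d -> R[i]) (n s : 'Z_d) :
  stft (fourier g) (fourier g) (n, s) =
  d%:R * (e s n * stft g g (- s, n)).
Proof.
pose h j := g (j + s) * e (j + s) (- n).
have hE l : (fourier g (l - n))^* * e l s = (fourier h l)^*.
  pose h0 j := g j * e j (- n).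
  have -> : fourier h l = e (- s) l * fourier h0 l.
    by rewrite -fourier_translate /fourier opprK.
  rewrite rmorphM /= conj_fourier_kernel // opprK fourier_kernelC mulrC.
  congr (_ * _^*); apply: eq_bigr => j _.
  by rewrite /h0 fourier_kernelDr // mulrA mulrAC.
rewrite /stft /=; under eq_bigr do rewrite -mulrA hE.
rewrite parseval; congr (_ * _); rewrite mulr_sumr; apply: eq_bigr => j _.
rewrite /h rmorphM /= conj_fourier_kernel // -fourier_kernelNC // opprK.
by rewrite opprK fourier_kernelDl //=; ring.
Qed.

Lemma ambiguity_eq (g f f' : 'Z_d -> R[i]) (n s : 'Z_d) :
    (forall kl, `|stft g f' kl| = `|stft g f kl|) -> stft g g (n, s) != 0 ->
  stft f' f' (n, s) = stft f f (n, s).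
Proof.
move=> ff' gns; have d0 : d%:R != 0 :> R[i] by rewrite pnatr_eq0 -lt0n ltnW.
have gns' : (stft g g (n, s))^* != 0 by rewrite conjC_eq0.
apply: (mulIf gns'); apply: (mulfI d0); rewrite -!spectrogram_fourier.
by apply: eq_bigr => k _; congr (_ * _); apply: eq_bigr => l _; rewrite ff'.
Qed.

Lemma lag_product_eq (f f' : 'Z_d -> R[i]) (n : 'Z_d) :
    (forall s, stft f' f' (n, s) = stft f f (n, s)) ->
  forall j, f' j * (f' (j - n))^* = f j * (f (j - n))^*.
Proof. by move=> ff'; apply: fourier_inj. Qed.

End Ambiguity.

(** * Signals with the same products at short lags *)

(** If points of [P] at distance at most [m] have the same colour, a change of
    colour between [0] and [N] takes place across a gap of [m] points outside
    [P].  The gap is found just after [s], the last point of [P] before [N], if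
    [s] still has the colour of [0], and before [s] otherwise. *)
Lemma color_change_gap (T : eqType) (P : pred nat) (c : nat -> T) (m N : nat) :
    (forall i j, (i < j <= i + m)%N -> P i -> P j -> c i = c j) ->
    P 0%N -> P N -> c 0%N != c N ->
  exists2 t, (t + m < N)%N & forall i, (i < m)%N -> ~~ P (t + i.+1)%N.
Proof.
move=> cP P0; elim/ltn_ind: N => N IH PN c0N.
have N_gt0 : (0 < N)%N by case: (N) c0N => //; rewrite eqxx.
have exs : exists s, P s && (s < N)%N by exists 0%N; rewrite P0.
case: (@ex_maxnP _ N exs) => [s /andP[_ /ltnW] //|s /andP[Ps ltsN] smax].
have [c0s|c0s] := eqVneq (c 0%N) (c s); last first.
  have [t lttm gap] := IH s ltsN Ps c0s.
  by exists t => //; apply: ltn_trans ltsN.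
have smN : (s + m < N)%N.
  rewrite ltnNge; apply: contraNN c0N => leN; rewrite c0s; apply/eqP.
  by apply: cP => //; rewrite ltsN.
exists s => // i ltim; apply/negP => Psi.
have /smax : P (s + i.+1)%N && (s + i.+1 < N)%N by rewrite Psi; lia.
lia.
Qed.

Lemma addn_val_oppZ (d : nat) (x : 'Z_d) :
  (1 < d)%N -> x != 0 -> (x + (- x)%R)%N = d.
Proof.
move=> d_gt1 x0; have x_gt0 : (0 < x)%N by rewrite lt0n.
have oppE :
  nat_of_ord (- x) = (((Zp_trunc d).+2 - x) %% (Zp_trunc d).+2)%N by [].
by rewrite oppE modn_small ?ltn_subrL ?x_gt0 // subnKC 1?ltnW // Zp_cast.
Qed.

Section ZeroRuns.
Variables (R : realType) (d m : nat) (f f' : 'Z_d -> R[i]).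
Hypothesis d_gt1 : (1 < d)%N.
Hypothesis lag : forall t, (t <= m)%N -> forall j,
  f' j * (f' (j - t%:R))^* = f j * (f (j - t%:R))^*.

Let norm_lag j : f' j * (f' j)^* = f j * (f j)^*.
Proof. by have := @lag 0%N (leq0n m) j; rewrite subr0. Qed.

(* Meaningful only on the support of [f]: elsewhere the division by zero gives
   zero. *)
Let ratio j := f' j / f j.

Let ratio_lag t j : (t <= m)%N -> f j != 0 -> f (j - t%:R) != 0 ->
  ratio (j - t%:R) = ratio j.
Proof.
move=> letm fj fjt; apply/eqP; rewrite /ratio eqr_div //; apply/eqP.
apply: (@mulIf _ (f (j - t%:R))^*); first by rewrite conjC_eq0.
rewrite -mulrA -lag // -[RHS]mulrA -norm_lag.
by ring.
Qed.

(** The run lies strictly inside the arc that goes up from [a] to [b]. *)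
Lemma run_of_zeros a b : f a != 0 -> f b != 0 -> ratio a != ratio b ->
  exists2 t, (t + m < nat_of_ord (b - a)%R)%N &
    forall i, (i < m)%N -> f (a + (t + i.+1)%:R) = 0.
Proof.
move=> fa fb rab; set N := nat_of_ord _.
have aN : a + N%:R = b by rewrite natr_Zp addrCA subrr addr0.
have [i j /andP[ltij leji] Pi Pj| | | |t tm gap] := @color_change_gap _
    (fun i => f (a + i%:R) != 0) (fun i => ratio (a + i%:R)) m N.
- have ijE : a + i%:R = a + j%:R - (j - i)%:R :> 'Z_d.
    by rewrite natrB 1?ltnW //; ring.
  by rewrite ijE ratio_lag -?ijE // leq_subLR.
- by rewrite addr0.
- by rewrite aN.
- by rewrite addr0 aN.
by exists t => // i /gap/negPn/eqP.
Qed.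

Lemma unimodular_multiple_or_zero_runs :
  (exists2 gamma : R[i], `|gamma| = 1 & forall j, f' j = gamma * f j) \/
  [/\ exists j, f j != 0,
      exists x, forall i, (i < m)%N -> f (x + i%:R) = 0
    & (2 * m <= #|[pred j | f j == 0%R]|)%N].
Proof.
have f'0 j : f j = 0 -> f' j = 0.
  move=> fj; have /eqP := norm_lag j.
  by rewrite fj mul0r mul_conjC_eq0 => /eqP.
have [/existsP[a fa]|/existsPn f0] := boolP [exists j, f j != 0]; last first.
  left; exists 1 => [|j]; first exact: normr1.
  by have /negPn/eqP fj := f0 j; rewrite fj mulr0 f'0.
have [/existsP[b /andP[fb rab]]|/existsPn rE] :=
    boolP [exists b, (f b != 0) && (ratio a != ratio b)]; last first.
  left; exists (ratio a) => [|j].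
    apply/eqP; rewrite -(@eqrXn2 _ 2) ?ler01 ?normr_ge0 // expr1n normCK.
    rewrite /ratio rmorphM fmorphV mulrACA -invfM norm_lag divff //.
    by rewrite mul_conjC_eq0.
  have [fj|fj] := eqVneq (f j) 0; first by rewrite fj mulr0 f'0.
  by have := rE j; rewrite fj negbK => /eqP->; rewrite /ratio divfK.
right.
have [t1 t1m gap1] := run_of_zeros fa fb rab.
have [t2 t2m gap2] : exists2 t, (t + m < nat_of_ord (a - b)%R)%N &
    forall i, (i < m)%N -> f (b + (t + i.+1)%:R) = 0.
  by apply: run_of_zeros => //; rewrite eq_sym.
split; first by exists a.
  exists (a + t1.+1%:R) => i lti.
  by rewrite -addrA -natrD addSnnS gap1.
have Nd : ((b - a)%R + (a - b)%R)%N = d.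
  rewrite -[a - b]opprB addn_val_oppZ // subr_eq0.
  by apply: contraNneq rab => ->.
(* The runs on the arcs from [a] to [b] and from [b] to [a], as offsets from
   [a]: all offsets are below [d], so the runs are disjoint. *)
set N1 := nat_of_ord (b - a) in t1m Nd; set N2 := nat_of_ord (a - b) in t2m Nd.
pose o (x : bool * 'I_m) := ((if x.1 then N1 + t2 else t1) + x.2.+1)%N.
pose phi x : 'Z_d := a + (o x)%:R.
have o_lt x : (o x < d)%N.
  by rewrite /o; case: x => -[] [i lti] /=; lia.
have phi_inj : injective phi.
  move=> x y /addrI/(congr1 val); rewrite /= !val_Zp_nat // !modn_small //.
  rewrite /o; case: x y => -[] [i lti] [[] [j ltj]] /= xy;
    by [lia | congr (_, _); apply: val_inj => /=; lia].
have -> : (2 * m)%N = #|codom phi|.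
  by rewrite card_codom // card_prod card_bool card_ord.
apply/subset_leq_card/fintype.subsetP => _ /codomP[[s i] ->].
rewrite inE /phi /o.
case: s => /=; last by rewrite gap1.
by rewrite -addnA natrD natr_Zp addrA (addrC a) subrK gap2.
Qed.

End ZeroRuns.

(** * Uncertainty principles *)

Section Uncertainty.
Variables (R : realType) (d : nat) (f : 'Z_d -> R[i]).
Hypothesis d_gt1 : (1 < d)%N.
Local Notation e := (@fourier_kernel R d).
Local Notation S := [pred j | f j != 0].

(* The enumeration of the support turns the Fourier transform into a linear
   system whose unknowns are the nonzero values of [f]. *)
Let fourier_supp l :
  fourier f l = \sum_(i < #|S|) f (enum_val i) * e (enum_val i) l.
Proof.
rewrite -(big_enum_val (A := S) (fun j => f j * e j l)) /fourier.
rewrite [LHS](bigID (mem S)) /= [X in _ + X]big1 ?addr0 // => j.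
by rewrite inE negbK => /eqP->; rewrite mul0r.
Qed.

Let enum_supp_eq0 :
  (forall i : 'I_#|S|, f (enum_val i) = 0) -> forall j, f j = 0.
Proof.
move=> f0 j; apply/eqP/negPn/negP => fj.
have jS : j \in S by [].
by case/eqP: fj; rewrite -(enum_rankK_in jS jS) f0.
Qed.

(** At [m] consecutive frequencies the Fourier system of a signal with at most
    [m] nonzero values contains a Vandermonde system. *)
Lemma fourier_zero_run (m : nat) (x : 'Z_d) :
    (#|S| <= m)%N -> (forall i, (i < m)%N -> fourier f (x + i%:R) = 0) ->
  forall j, f j = 0.
Proof.
move=> leSm fx0; apply: enum_supp_eq0.
pose a (i : 'I_#|S|) : 'Z_d := enum_val i.
have e1_inj : injective (fun i => e (a i) 1).
  move=> i j; rewrite -(natr_Zp (a i)) -(natr_Zp (a j)) /=.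
  rewrite !(fourier_kernel_natr _ d_gt1 _ 1) // !muln1 => /eqP.
  rewrite (eq_prim_root_expr (omega_prim_root R (ltnW d_gt1))).
  rewrite !modn_small -?[X in (_ < X)%N](Zp_cast d_gt1) // => /eqP.
  by move=> /val_inj/enum_val_inj.
have v0 := @det_neq0_ker _ _ _ (fun i => f (a i) * e (a i) x)
  (det_Vandermonde_neq0 e1_inj).
move=> j; apply: (mulIf (fourier_kernel_neq0 R (a j) x)); rewrite mul0r.
apply: v0 => i; rewrite -[RHS](fx0 i) ?(leq_trans _ leSm) // fourier_supp.
apply: eq_bigr => l _; rewrite !mxE fourier_kernelDr // [LHS]mulrC -mulrA.
congr (_ * (_ * _)).
rewrite -/(a l) -(natr_Zp (a l)) (fourier_kernel_natr _ d_gt1 _ 1) muln1.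
by rewrite fourier_kernel_natr // exprM.
Qed.

Lemma prime_uncertainty :
    prime d -> (#|S| <= #|[pred l | fourier f l == 0%R]|)%N ->
  forall j, f j = 0.
Proof.
move=> d_pr leS; apply: enum_supp_eq0.
have ZdE := Zp_cast d_gt1.
pose a (i : 'I_#|S|) : 'Z_d := enum_val i.
pose b (i : 'I_#|S|) : 'Z_d := enum_val (widen_ord leS i).
apply: (det_neq0_ker (@chebotarev_minor_neq0 _ _ _ _
    (fun i => cast_ord ZdE (b i)) (fun j => cast_ord ZdE (a j))
    d_pr (omega_prim_root R (ltnW d_gt1)) _ _)).
- by move=> i j /cast_ord_inj/enum_val_inj/(congr1 val) /= ij; apply: val_inj.
- by move=> i j /cast_ord_inj/enum_val_inj.
move=> i; have : b i \in [pred l | fourier f l == 0] by apply: enum_valP.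
rewrite inE fourier_supp => /eqP fb; rewrite -[RHS]fb.
by apply: eq_bigr => j _; rewrite mxE fourier_kernelE mulnC mulrC.
Qed.

End Uncertainty.

(** * Phase retrieval with a window and its Fourier transform *)

Local Open Scope classical_set_scope.

Theorem theorem2p6 (R : realType) (d : nat) (m : int) (g : 'Z_d -> R[i]) :
  (2 <= d)%N ->
  mstar d < m%:~R ->
  residues d (- m) m `*` [set: 'Z_d] `<=` supp (stft g g) ->
  strong_two_window_phase_retrieval g (fourier g).
Proof.
move=> d_gt1; case: m => [m|m] m_gt g_supp f; last first.
  have : 0 <= mstar d.
    by rewrite /mstar; case: ifP => _; rewrite divr_ge0 // subr_ge0 ler1n ltnW.
  by move=> /le_lt_trans/(_ m_gt); rewrite ltr0z.
have gP (t : nat) s : (t <= m)%N -> stft g g (t%:R, s) != 0.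
  move=> letm; apply: g_supp; split=> //=.
  by exists t%:Z => //=; lia.
have gN (t : nat) s : (t <= m)%N -> stft g g (- t%:R, s) != 0.
  move=> letm; apply: g_supp; split=> //=.
  by exists (- t%:Z) => /=; [lia | rewrite mulrNz -pmulrn].
(* The quarter turn exchanges lags and frequencies, with a sign. *)
have fourier_g (t : nat) s : (t <= m)%N ->
    stft (fourier g) (fourier g) (s, t%:R) != 0.
  move=> letm; rewrite stft_fourier_diag // !mulf_neq0 ?fourier_kernel_neq0 //.
    by rewrite pnatr_eq0 -lt0n ltnW.
  exact: gN.
pose f_zeros := #|[pred j | f j == 0%R]|.
have supp_zeros : (#|[pred j | f j != 0%R]| + f_zeros)%N = d.
  rewrite addnC -[RHS](Zp_cast d_gt1) -[RHS]card_ord.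
  rewrite -(cardC [pred j | f j == 0%R]).
  by congr (_ + _)%N.
(* Failure of [g] leaves [f] nonzero with at least [2 * m] zeros. *)
have [f_ok|f_zeros_ge] : phase_retrievable g f \/
    (exists j, f j != 0) /\ (2 * m <= f_zeros)%N.
  apply: contrapT => /not_orP[nf nz]; apply: nf => f' ff'.
  have [] // := @unimodular_multiple_or_zero_runs R d m f f' d_gt1; last first.
    by move=> [ex _ zeros]; case: nz.
  move=> t letm; apply: lag_product_eq => // s.
  by apply: ambiguity_eq ff' _ => //; apply: gP.
  by left.
right=> f' ff'.
have [||] := @unimodular_multiple_or_zero_runs
  R d m (fourier f) (fourier f') d_gt1.
- move=> t letm; apply: lag_product_eq => // s.
  rewrite !stft_fourier_diag //; congr (_ * (_ * _)).
  by apply: ambiguity_eq ff' _ => //; apply: fourier_g.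
- move=> [gamma gamma1 fourier_f']; exists gamma => // j.
  apply: (fourier_inj d_gt1 (f' := fun i => gamma * f i)) => l.
  by rewrite fourierZ.
move=> [_ [x fx0] fhat_zeros]; case: f_zeros_ge => -[j fj] f_zeros_ge.
case/eqP: fj; move: m_gt; rewrite /mstar; case: ifP => [d_pr|_] m_gt.
  apply: prime_uncertainty => //; apply: leq_trans fhat_zeros.
  have : (d%:Z - 1 < 4 * m%:Z) by rewrite -(ltr_int rat); lra.
  lia.
apply: (@fourier_zero_run _ _ _ d_gt1 m x) => //.
have : (d%:Z - 1 < 3 * m%:Z) by rewrite -(ltr_int rat); lra.
lia.
Qed.
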